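(* Let $L\ge 1$, weights $w_1,\dots,w_L>0$, a power budget $P_{\mathrm T}>0$, and complex channel matrices $\mathbf H_{l,k}\in\mathbb C^{L_{R_l}\times L_{T_k}}$ ($l,k=1,\dots,L$) be given. Let $\{\mathbf\Sigma^{(n)}\}_{n\ge 0}$ be the sequence of forward covariance tuples produced by the Dual Link Algorithm (defined in the context) from an initial point $\mathbf\Sigma^{(0)}$ with $\mathbf\Sigma^{(0)}_l\succeq 0$ for all $l$ and $\sum_l\mathrm{Tr}(\mathbf\Sigma^{(0)}_l)=P_{\mathrm T}$, and assume all the normalizing denominators in the algorithm are strictly positive at every iteration, so that the algorithm is well defined. Then the weighted sum-rate is monotonically nondecreasing along the iterations: $V(\mathbf\Sigma^{(n)})\le V(\mathbf\Sigma^{(n+1)})$ for all $n\ge 0$.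
   Context: For Hermitian positive semidefinite $\mathbf\Sigma_l\in\mathbb C^{L_{T_l}\times L_{T_l}}$, $l=1,\dots,L$, write $\mathbf\Sigma=\mathbf\Sigma_{1:L}$ and define the forward interference-plus-noise covariances $\mathbf\Omega_l=\mathbf I+\sum_{k\ne l}\mathbf H_{l,k}\mathbf\Sigma_k\mathbf H_{l,k}^\dagger$. The weighted sum-rate is $V(\mathbf\Sigma)=\sum_{l=1}^L w_l\big(\log|\mathbf\Omega_l+\mathbf H_{l,l}\mathbf\Sigma_l\mathbf H_{l,l}^\dagger|-\log|\mathbf\Omega_l|\big)$, where $|\cdot|$ is the determinant and $^\dagger$ the conjugate transpose. Dual Link Algorithm: given $\mathbf\Sigma^{(n)}$ (with total trace $P_{\mathrm T}$), compute (i) $\mathbf\Omega_l=\mathbf I+\sum_{k\ne l}\mathbf H_{l,k}\mathbf\Sigma^{(n)}_k\mathbf H_{l,k}^\dagger$; (ii) $\hat{\mathbf\Sigma}_l=\dfrac{P_{\mathrm T}\,w_l\big(\mathbf\Omega_l^{-1}-(\mathbf\Omega_l+\mathbf H_{l,l}\mathbf\Sigma^{(n)}_l\mathbf H_{l,l}^\dagger)^{-1}\big)}{\sum_{j=1}^L w_j\,\mathrm{Tr}\big(\mathbf\Omega_j^{-1}-(\mathbf\Omega_j+\mathbf H_{j,j}\mathbf\Sigma^{(n)}_j\mathbf H_{j,j}^\dagger)^{-1}\big)}$; (iii) $\hat{\mathbf\Omega}_l=\mathbf I+\sum_{k\ne l}\mathbf H_{k,l}^\dagger\hat{\mathbf\Sigma}_k\mathbf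 H_{k,l}$; (iv) $\mathbf\Sigma^{(n+1)}_l=\dfrac{P_{\mathrm T}\,w_l\big(\hat{\mathbf\Omega}_l^{-1}-(\hat{\mathbf\Omega}_l+\mathbf H_{l,l}^\dagger\hat{\mathbf\Sigma}_l\mathbf H_{l,l})^{-1}\big)}{\sum_{j=1}^L w_j\,\mathrm{Tr}\big(\hat{\mathbf\Omega}_j^{-1}-(\hat{\mathbf\Omega}_j+\mathbf H_{j,j}^\dagger\hat{\mathbf\Sigma}_j\mathbf H_{j,j})^{-1}\big)}$, for $l=1,\dots,L$. *)

(* Defs.v *)
From Stdlib Require Import Reals Lra ClassicalEpsilon FunctionalExtensionality.
From HB Require Import structures.
From mathcomp Require Import all_boot all_order all_algebra.
Set Implicit Arguments. Unset Strict Implicit. Unset Printing Implicit Defensive.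
Import GRing.Theory.
Local Open Scope R_scope.

Definition Req_bool (x y : R) : bool := if Req_EM_T x y then true else false.
Lemma Req_boolP : Equality.axiom Req_bool.
Proof. move=> x y; rewrite /Req_bool; case: Req_EM_T => h; [exact: ReflectT|exact: ReflectF]. Qed.
HB.instance Definition _ := hasDecEq.Build R Req_boolP.

Definition R_find (P : pred R) (n : nat) : option R :=
  match excluded_middle_informative (exists x, P x) with
  | left h => Some (proj1_sig (constructive_indefinite_description _ h))
  | right _ => None
  end.
Lemma R_find_correct P n x : R_find P n = Some x -> P x.
Proof.
rewrite /R_find; case: excluded_middle_informative => // h [<-].
exact: (proj2_sig (constructive_indefinite_description _ h)).
Qed.
Lemma R_find_complete (P : pred R) : (exists x, P x) -> exists n, R_find P n.
Proof. move=> h; exists 0%N; rewrite /R_find; by case: excluded_middle_informative. Qed.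
Lemma R_find_ext (P Q : pred R) : P =1 Q -> R_find P =1 R_find Q.
Proof. move=> e n; have -> : P = Q by apply: functional_extensionality. by []. Qed.
HB.instance Definition _ := hasChoice.Build R R_find_correct R_find_complete R_find_ext.

Record complex := Cplx { cre : R; cim : R }.
Definition C2p (z : complex) := (cre z, cim z).
Definition p2C (p : R * R) := Cplx p.1 p.2.
Lemma C2pK : cancel C2p p2C. Proof. by case. Qed.
HB.instance Definition _ := Choice.copy complex (can_type C2pK).

Definition C0 := Cplx 0 0.
Definition C1 := Cplx 1 0.
Definition Cadd (x y : complex) := Cplx (cre x + cre y) (cim x + cim y).
Definition Copp (x : complex) := Cplx (- cre x) (- cim x).
Definition Cmul (x y : complex) :=
  Cplx (cre x * cre y - cim x * cim y) (cre x * cim y + cim x * cre y).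
Definition Cinv (x : complex) :=
  let d := cre x * cre x + cim x * cim x in Cplx (cre x / d) (- cim x / d).

Lemma CaddA : associative Cadd.
Proof. by case=> a b [c d] [e f]; rewrite /Cadd /Copp /C0 /=; f_equal; ring. Qed.
Lemma CaddC : commutative Cadd.
Proof. by case=> a b [c d]; rewrite /Cadd /Copp /C0 /=; f_equal; ring. Qed.
Lemma Cadd0 : left_id C0 Cadd.
Proof. by case=> a b; rewrite /Cadd /Copp /C0 /=; f_equal; ring. Qed.
Lemma CaddN : left_inverse C0 Copp Cadd.
Proof. by case=> a b; rewrite /Cadd /Copp /C0 /=; f_equal; ring. Qed.
HB.instance Definition _ := GRing.isZmodule.Build complex CaddA CaddC Cadd0 CaddN.

Lemma CmulA : associative Cmul.
Proof. by case=> a b [c d] [e f]; rewrite /Cmul /C1 /=; f_equal; ring. Qed.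
Lemma CmulC : commutative Cmul.
Proof. by case=> a b [c d]; rewrite /Cmul /C1 /=; f_equal; ring. Qed.
Lemma Cmul1 : left_id C1 Cmul.
Proof. by case=> a b; rewrite /Cmul /C1 /=; f_equal; ring. Qed.
Lemma CmulDl : left_distributive Cmul Cadd.
Proof. by case=> a b [c d] [e f]; rewrite /Cmul /Cadd /=; f_equal; ring. Qed.
Lemma C1_neq0 : C1 != C0.
Proof. apply/eqP=> h; have := f_equal cre h; rewrite /=; lra. Qed.
HB.instance Definition _ := GRing.Zmodule_isComNzRing.Build complex CmulA CmulC Cmul1 CmulDl C1_neq0.

Local Open Scope ring_scope.
Lemma CmulV (x : complex) : x != 0 -> Cmul (Cinv x) x = 1.
Proof.
case: x => a b /eqP nz.
have hd : Rplus (Rmult a a) (Rmult b b) <> R0.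
  move=> hd; apply: nz.
  have ha : a = R0 by nra.
  have hb : b = R0 by nra.
  by rewrite ha hb.
rewrite /Cmul /Cinv /=; apply: (f_equal2 Cplx); simpl; field; exact: hd.
Qed.
Lemma Cinv0 : Cinv 0 = 0.
Proof.
rewrite /Cinv /=; apply: (f_equal2 Cplx); rewrite /= /Rdiv;
  rewrite ?Ropp_0; apply: Rmult_0_l.
Qed.
HB.instance Definition _ := GRing.ComNzRing_isField.Build complex CmulV Cinv0.

Definition RtoC (r : R) : complex := Cplx r R0.
Definition conjc (z : complex) : complex := Cplx (cre z) (- cim z).

Local Open Scope ring_scope.

Definition ctr (m n : nat) (A : 'M[complex]_(m, n)) : 'M[complex]_(n, m) := (map_mx conjc A)^T.

Definition psd (n : nat) (A : 'M[complex]_n) : Prop :=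
  ctr A = A /\ forall v : 'cV[complex]_n, Rle R0 (cre ((ctr v *m A *m v) 0 0)).

Definition cpos (z : complex) : Prop := cim z = R0 /\ Rlt R0 (cre z).

Section DLA.
Variables (L : nat) (LT LR : 'I_L -> nat)
          (H : forall l k : 'I_L, 'M[complex]_(LR l, LT k)) (w : 'I_L -> R) (PT : R).

Definition Cov := forall l : 'I_L, 'M[complex]_(LT l).

Definition Omega (S : Cov) (l : 'I_L) : 'M[complex]_(LR l) :=
  1%:M + \sum_(k < L | k != l) (H l k *m S k *m ctr (H l k)).
Definition OmegaS (S : Cov) (l : 'I_L) : 'M[complex]_(LR l) :=
  Omega S l + H l l *m S l *m ctr (H l l).

Definition Vrate (S : Cov) : R :=
  \big[Rplus/R0]_(l < L)
    Rmult (w l) (Rminus (ln (cre (\det (OmegaS S l)))) (ln (cre (\det (Omega S l))))).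

Definition fwdD (S : Cov) (l : 'I_L) : 'M[complex]_(LR l) :=
  invmx (Omega S l) - invmx (OmegaS S l).
Definition fwd_denom (S : Cov) : complex := \sum_(j < L) RtoC (w j) * \tr (fwdD S j).
Definition SigHat (S : Cov) (l : 'I_L) : 'M[complex]_(LR l) :=
  (RtoC (Rmult PT (w l)) / fwd_denom S) *: fwdD S l.

Definition OmegaHat (S : Cov) (l : 'I_L) : 'M[complex]_(LT l) :=
  1%:M + \sum_(k < L | k != l) (ctr (H k l) *m SigHat S k *m H k l).
Definition OmegaHatS (S : Cov) (l : 'I_L) : 'M[complex]_(LT l) :=
  OmegaHat S l + ctr (H l l) *m SigHat S l *m H l l.

Definition bwdD (S : Cov) (l : 'I_L) : 'M[complex]_(LT l) :=
  invmx (OmegaHat S l) - invmx (OmegaHatS S l).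
Definition bwd_denom (S : Cov) : complex := \sum_(j < L) RtoC (w j) * \tr (bwdD S j).
Definition DLA_step (S : Cov) : Cov :=
  fun l => (RtoC (Rmult PT (w l)) / bwd_denom S) *: bwdD S l.

End DLA.

(* Main.v *)
(* The reciprocal network, with channels [H l k]^+ reversed, satisfies
   [V(S) <= V'(T)], where [T] is the tuple of normalized matrices
   [w_l (Om_l^-1 - (Om_l + H_ll S_l H_ll^+)^-1)]. A Dual Link iteration applies
   this to the network and then to its reciprocal, so it suffices to prove it
   once. On each link a matrix inequality (lemma [link_duality]) bounds the rate
   of the original link by the rate of the reversed one plus
   [Tr (S_l Om'_l) / t - Tr (D_l Om_l)]; these trace terms cancel in the weighted
   sum, because [S] and [T] have the same total trace and the cross terms
   [Tr (T_l H_lk S_k H_lk^+)] are counted once on either side. *)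

Require Import Defs.
From Stdlib Require Import Reals Lra FunctionalExtensionality.
From HB Require Import structures.
From mathcomp Require Import all_boot all_order all_algebra.
Set Implicit Arguments.
Unset Strict Implicit.
Unset Printing Implicit Defensive.
Import GRing.Theory.
Local Open Scope ring_scope.

(** * Complex scalars, the embedding of the reals, and conjugation *)

Lemma creD (x y : complex) : cre (x + y) = Rplus (cre x) (cre y).
Proof. by []. Qed.

Lemma creN (x : complex) : cre (- x) = Ropp (cre x).
Proof. by []. Qed.

Lemma cre_scale (r : R) (x : complex) : cre (RtoC r * x) = Rmult r (cre x).
Proof. case: x => a b; rewrite /GRing.mul /=; ring. Qed.

Lemma complex_eq (x y : complex) : cre x = cre y -> cim x = cim y -> x = y.
Proof. by case: x y => a b [c d] /= -> ->. Qed.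

Lemma RtoC_mul (a b : R) : RtoC a * RtoC b = RtoC (Rmult a b).
Proof. by apply: complex_eq; rewrite /GRing.mul /=; ring. Qed.

Lemma RtoC_inv (a : R) : a <> R0 -> (RtoC a)^-1 = RtoC (Rinv a).
Proof. by move=> a0; apply: complex_eq; rewrite /GRing.inv /=; field. Qed.

(** Registering [conjc] as a ring morphism lets the general [map_mx] laws yield those of [ctr]. *)
Lemma conjc_is_zmod_morphism : zmod_morphism conjc.
Proof. by case=> a b [c d]; apply: complex_eq; rewrite /= ?/GRing.add /=; ring. Qed.
HB.instance Definition _ :=
  GRing.isZmodMorphism.Build complex complex conjc conjc_is_zmod_morphism.

Lemma conjc_is_monoid_morphism : monoid_morphism conjc.
Proof.
split; first by apply: complex_eq; rewrite /=; ring.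
by case=> a b [c d]; apply: complex_eq; rewrite /GRing.mul /=; ring.
Qed.
HB.instance Definition _ :=
  GRing.isMonoidMorphism.Build complex complex conjc conjc_is_monoid_morphism.

Lemma conjcK : involutive conjc.
Proof. by case=> a b; apply: complex_eq; rewrite /=; ring. Qed.

Lemma conjc_RtoC (r : R) : conjc (RtoC r) = RtoC r.
Proof. by apply: complex_eq; rewrite /=; ring. Qed.

Lemma conjc_mul_re (z : complex) :
  conjc z * z = RtoC (Rplus (Rmult (cre z) (cre z)) (Rmult (cim z) (cim z))).
Proof. by case: z => a b; apply: complex_eq; rewrite /GRing.mul /=; ring. Qed.

Lemma cre_sum (I : Type) (r : seq I) (F : I -> complex) :
  cre (\sum_(i <- r) F i) = \big[Rplus/R0]_(i <- r) cre (F i).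
Proof. by elim/big_rec2: _ => // i y x _ <-. Qed.

(** * Conjugate transposes *)

Lemma ctrK (m n : nat) (A : 'M[complex]_(m, n)) : ctr (ctr A) = A.
Proof. by apply/matrixP => i j; rewrite !mxE conjcK. Qed.

Lemma ctrD (m n : nat) (A B : 'M[complex]_(m, n)) : ctr (A + B) = ctr A + ctr B.
Proof. by rewrite /ctr map_mxD linearD. Qed.

Lemma ctrN (m n : nat) (A : 'M[complex]_(m, n)) : ctr (- A) = - ctr A.
Proof. by rewrite /ctr map_mxN linearN. Qed.

Lemma ctrM (m n p : nat) (A : 'M[complex]_(m, n)) (B : 'M[complex]_(n, p)) :
  ctr (A *m B) = ctr B *m ctr A.
Proof. by rewrite /ctr map_mxM trmx_mul. Qed.

Lemma ctrZ (m n : nat) (a : complex) (A : 'M[complex]_(m, n)) :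
  ctr (a *: A) = conjc a *: ctr A.
Proof. by rewrite /ctr map_mxZ linearZ. Qed.

Lemma ctr1 (n : nat) : ctr (1%:M : 'M[complex]_n) = 1%:M.
Proof. by rewrite /ctr map_mx1 trmx1. Qed.

Lemma ctr0 (m n : nat) : ctr (0 : 'M[complex]_(m, n)) = 0.
Proof. by rewrite /ctr map_mx0 trmx0. Qed.

Lemma ctrV (n : nat) (A : 'M[complex]_n) : ctr (invmx A) = invmx (ctr A).
Proof. by rewrite /ctr map_invmx trmx_inv. Qed.

Lemma ctr_col_mx (m n p : nat) (A : 'M[complex]_(m, p)) (B : 'M[complex]_(n, p)) :
  ctr (col_mx A B) = row_mx (ctr A) (ctr B).
Proof. by rewrite /ctr map_col_mx tr_col_mx. Qed.

Lemma ctr_block_mx (m1 m2 n1 n2 : nat) (A : 'M[complex]_(m1, n1))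
    (B : 'M[complex]_(m1, n2)) (C : 'M[complex]_(m2, n1)) (D : 'M[complex]_(m2, n2)) :
  ctr (block_mx A B C D) = block_mx (ctr A) (ctr C) (ctr B) (ctr D).
Proof. by rewrite /ctr map_block_mx tr_block_mx. Qed.

(** * Quadratic forms, positive definite and semidefinite matrices *)

Definition qf (n : nat) (A : 'M[complex]_n) (v : 'cV[complex]_n) : R :=
  cre ((ctr v *m A *m v) 0 0).

Definition pd (n : nat) (A : 'M[complex]_n) : Prop :=
  ctr A = A /\ forall v : 'cV[complex]_n, v != 0 -> Rlt R0 (qf A v).

Lemma qfD (n : nat) (A B : 'M[complex]_n) (v : 'cV[complex]_n) :
  qf (A + B) v = Rplus (qf A v) (qf B v).
Proof. by rewrite /qf mulmxDr mulmxDl mxE. Qed.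

Lemma qfZ (n : nat) (r : R) (A : 'M[complex]_n) (v : 'cV[complex]_n) :
  qf (RtoC r *: A) v = Rmult r (qf A v).
Proof. by rewrite /qf -scalemxAr -scalemxAl mxE cre_scale. Qed.

Lemma qf_congr (m n : nat) (A : 'M[complex]_n) (B : 'M[complex]_(n, m)) (v : 'cV[complex]_m) :
  qf (ctr B *m A *m B) v = qf A (B *m v).
Proof. by rewrite /qf ctrM !mulmxA. Qed.

Lemma qf1 (n : nat) (v : 'cV[complex]_n) :
  qf 1%:M v = \big[Rplus/R0]_(i < n)
    Rplus (Rmult (cre (v i 0)) (cre (v i 0))) (Rmult (cim (v i 0)) (cim (v i 0))).
Proof.
rewrite /qf mulmx1 mxE cre_sum; apply: eq_bigr => i _.
by rewrite !mxE conjc_mul_re.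
Qed.

Lemma pd1 (n : nat) : pd (1%:M : 'M[complex]_n).
Proof.
split; first exact: ctr1.
have sq0 x y : Rle R0 (Rplus (Rmult x x) (Rmult y y)) by nra.
have sum0 (r : seq 'I_n) (v : 'cV[complex]_n) : Rle R0 (\big[Rplus/R0]_(i <- r)
    Rplus (Rmult (cre (v i 0)) (cre (v i 0))) (Rmult (cim (v i 0)) (cim (v i 0)))).
  by elim/big_ind: _ => [|x y hx hy|i _]; [exact: Rle_refl|lra|].
move=> v v0; rewrite qf1.
have [i vi] : exists i, v i 0 != 0.
  apply/existsP; apply: contraR v0; rewrite negb_exists => /forallP h; apply/eqP/matrixP => i j.
  by rewrite (ord1 j) mxE; apply/eqP/negPn/h.
have : i \in index_enum 'I_n by rewrite mem_index_enum.
elim: (index_enum 'I_n) => // j r IH; rewrite inE big_cons => /orP [/eqP <- | /IH].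
  apply: Rplus_lt_le_0_compat; last exact: sum0.
  have := sq0 (cre (v i 0)) (cim (v i 0)).
  case/Rle_lt_or_eq_dec => // h0.
  case/eqP: vi; apply: complex_eq => /=; nra.
by move=> IHr; apply: Rplus_le_lt_0_compat; first exact: sq0.
Qed.

Lemma psdD (n : nat) (A B : 'M[complex]_n) : psd A -> psd B -> psd (A + B).
Proof.
move=> [hA pA] [hB pB]; split=> [|v]; first by rewrite ctrD hA hB.
by have := pA v; have := pB v; have := qfD A B v; rewrite /qf; lra.
Qed.

Lemma psd0 (n : nat) : psd (0 : 'M[complex]_n).
Proof.
by split=> [|v]; [exact: ctr0 | rewrite mulmx0 mul0mx mxE; exact: Rle_refl].
Qed.

Lemma psd_congr (m n : nat) (A : 'M[complex]_n) (B : 'M[complex]_(n, m)) :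
  psd A -> psd (ctr B *m A *m B).
Proof.
move=> [hA pA]; split=> [|v]; first by rewrite !ctrM ctrK hA mulmxA.
by have := pA (B *m v); rewrite -!/(qf _ _) qf_congr.
Qed.

Lemma psdZ (n : nat) (r : R) (A : 'M[complex]_n) : Rle 0 r -> psd A -> psd (RtoC r *: A).
Proof.
move=> r0 [hA pA]; split=> [|v]; first by rewrite ctrZ conjc_RtoC hA.
by rewrite -/(qf _ _) qfZ; have := pA v; rewrite -/(qf _ _); nra.
Qed.

Lemma pd_psd (n : nat) (A : 'M[complex]_n) : pd A -> psd A.
Proof.
move=> [hA pA]; split=> // v; rewrite -/(qf _ _).
have [->|v0] := eqVneq v 0; last exact/Rlt_le/pA.
by rewrite /qf mulmx0 mxE; exact: Rle_refl.
Qed.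

Lemma pdD (n : nat) (A B : 'M[complex]_n) : pd A -> psd B -> pd (A + B).
Proof.
move=> [hA pA] [hB pB]; split=> [|v v0]; first by rewrite ctrD hA hB.
by have := pA v v0; have := pB v; rewrite qfD -/(qf B v); lra.
Qed.

(** A nonzero null vector would make the form vanish; the transpose turns the row vectors of [kermx]
    into columns. *)
Lemma pd_unitmx (n : nat) (A : 'M[complex]_n) : pd A -> A \in unitmx.
Proof.
move=> [hA pA]; rewrite -unitmx_tr -row_free_unit -kermx_eq0.
apply/negPn/negP => /rowV0Pn [u /sub_kermxP uA u0].
have Au : A *m u^T = 0 by apply: trmx_inj; rewrite trmx_mul trmxK uA trmx0.
have uT0 : u^T != 0 by apply: contra_neq u0 => h; apply: trmx_inj; rewrite h trmx0.
by have := pA _ uT0; rewrite /qf -mulmxA Au mulmx0 mxE /=; lra.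
Qed.

Lemma pdV (n : nat) (A : 'M[complex]_n) : pd A -> pd (invmx A).
Proof.
move=> pA; have uA := pd_unitmx pA; have [hA qA] := pA.
split=> [|v v0]; first by rewrite ctrV hA.
have -> : invmx A = ctr (invmx A) *m A *m invmx A by rewrite ctrV hA mulVmx // mul1mx.
rewrite qf_congr; apply: qA; apply: contra_neq v0 => h.
by rewrite -[v]mul1mx -(mulmxV uA) -mulmxA h mulmx0.
Qed.

Lemma psd_diag (n : nat) (A : 'M[complex]_n) (i : 'I_n) : psd A -> Rle 0 (cre (A i i)).
Proof.
move=> [hA pA]; have := pA (delta_mx i 0).
have -> : ctr (delta_mx i 0 : 'cV[complex]_n) = delta_mx 0 i.
  by rewrite /ctr map_delta_mx trmx_delta.
by rewrite -rowE -colE !mxE.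
Qed.

Definition rtr (n : nat) (A : 'M[complex]_n) : R := cre (\tr A).

(** Taking the real part loses nothing on positive definite matrices, whose determinants are real by
    [det_pd]. *)
Definition ldet (n : nat) (A : 'M[complex]_n) : R := ln (cre (\det A)).

Lemma psd_tr (n : nat) (A : 'M[complex]_n) : psd A -> Rle 0 (rtr A).
Proof.
move=> pA; rewrite /rtr /mxtrace cre_sum; elim/big_ind: _ => [|x y|i _]; [exact: Rle_refl|lra|].
exact: psd_diag.
Qed.

(** If [w = A v] were nonzero, moving [v] slightly along [-w] would make the form negative, since
    its derivative at [v] in direction [w] is [2 |w|^2]. *)
Lemma psd_qf0 (n : nat) (A : 'M[complex]_n) (v : 'cV[complex]_n) :
  psd A -> qf A v = R0 -> A *m v = 0.
Proof.
move=> pA v0; apply/eqP/negPn/negP => Av0.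
have [_ /(_ _ Av0) pos] := pd1 n.
set w := A *m v in Av0 pos.
have [hA qA] := pA.
have wAv : qf 1%:M w = cre ((ctr w *m A *m v) 0 0) by rewrite /qf mulmx1 -mulmxA.
have vAw : qf 1%:M w = cre ((ctr v *m A *m w) 0 0) by rewrite /qf mulmx1 {1}/w ctrM hA.
have eD (B C : 'M[complex]_1) : cre ((B + C) 0 0) = Rplus (cre (B 0 0)) (cre (C 0 0)).
  by rewrite mxE.
have eZ r (B : 'M[complex]_1) : cre ((RtoC r *: B) 0 0) = Rmult r (cre (B 0 0)).
  by rewrite mxE cre_scale.
have step t : Rle 0 (Rplus (Rmult 2 (Rmult t (qf 1%:M w))) (Rmult (Rmult t t) (qf A w))).
  have := qA (v + RtoC t *: w).
  rewrite ctrD ctrZ conjc_RtoC !mulmxDl !mulmxDr -!scalemxAl -!scalemxAr.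
  rewrite !eD !eZ -!/(qf _ _) -wAv -vAw v0; lra.
have w0 : Rle 0 (qf A w) by exact: qA.
(* With [x = |w|^2] and [y = qf A w], the step [t = - x / (1 + y)] needs no case split on [y = 0]
   and gives the value [- x^2 (2 + y) / (1 + y)^2 < 0]. *)
have := step (Ropp (Rdiv (qf 1%:M w) (Rplus 1 (qf A w)))).
set x := qf 1%:M w in pos *; set y := qf A w in w0 *.
have -> : Rplus (Rmult 2 (Rmult (Ropp (Rdiv x (Rplus 1 y))) x)) (Rmult (Rmult (Ropp (Rdiv x (Rplus 1 y))) (Ropp (Rdiv x (Rplus 1 y)))) y)
  = Rmult (Ropp (Rmult x x)) (Rdiv (Rplus 2 y) (Rmult (Rplus 1 y) (Rplus 1 y))).
  by field; lra.
have : Rlt 0 (Rdiv (Rplus 2 y) (Rmult (Rplus 1 y) (Rplus 1 y))).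
  by apply: Rdiv_lt_0_compat; nra.
move=> k0; have := Rmult_lt_0_compat _ _ (Rmult_lt_0_compat _ _ pos pos) k0; lra.
Qed.

(** * Schur complements *)

Lemma det_schur_ul (F : fieldType) (m n : nat) (A : 'M[F]_m) (B : 'M[F]_(m, n))
    (C : 'M[F]_(n, m)) (D : 'M[F]_n) :
  A \in unitmx -> \det (block_mx A B C D) = \det A * \det (D - C *m invmx A *m B).
Proof.
move=> uA.
have -> : block_mx A B C D =
    block_mx 1%:M 0 (C *m invmx A) 1%:M *m block_mx A B 0 (D - C *m invmx A *m B).
  rewrite mulmx_block !mul1mx !mul0mx ?mulmx0 !addr0 mulmxKV //.
  by rewrite addrC subrK.
by rewrite det_mulmx det_lblock det_ublock !det1 !mul1r.
Qed.

Lemma det_schur_dr (F : fieldType) (m n : nat) (A : 'M[F]_m) (B : 'M[F]_(m, n))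
    (C : 'M[F]_(n, m)) (D : 'M[F]_n) :
  D \in unitmx -> \det (block_mx A B C D) = \det D * \det (A - B *m invmx D *m C).
Proof.
move=> uD.
have -> : block_mx A B C D =
    block_mx 1%:M (B *m invmx D) 0 1%:M *m block_mx (A - B *m invmx D *m C) 0 C D.
  rewrite mulmx_block !mul1mx !mul0mx ?mulmx0 ?addr0 ?add0r mulmxKV //.
  by rewrite subrK.
by rewrite det_mulmx det_lblock det_ublock !det1 !mul1r mulrC.
Qed.

(** The upper block is chosen to solve [A u + B x = 0], so only the lower block row contributes.
    Schur complements thereby inherit positivity from the block matrix. *)
Lemma qf_schur (m n : nat) (A : 'M[complex]_m) (B : 'M[complex]_(m, n))
    (C : 'M[complex]_(n, m)) (D : 'M[complex]_n) (x : 'cV[complex]_n) :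
  A \in unitmx ->
  qf (block_mx A B C D) (col_mx (- (invmx A *m B *m x)) x) = qf (D - C *m invmx A *m B) x.
Proof.
move=> uA; rewrite /qf -mulmxA mul_block_col ctr_col_mx mul_row_col.
rewrite !mulmxN !mulmxA mulmxV // mul1mx addNr mulmx0 add0r.
by rewrite -(mulmxA (ctr x)) mulmxBl [- _ + _]addrC.
Qed.

Lemma qf_ul (m n : nat) (A : 'M[complex]_m) (B : 'M[complex]_(m, n))
    (C : 'M[complex]_(n, m)) (D : 'M[complex]_n) (x : 'cV[complex]_m) :
  qf (block_mx A B C D) (col_mx x 0) = qf A x.
Proof.
rewrite /qf -mulmxA mul_block_col ctr_col_mx mul_row_col !mulmx0 !addr0.
by rewrite ctr0 mul0mx addr0 mulmxA.
Qed.

Lemma qf_dr (m n : nat) (A : 'M[complex]_m) (B : 'M[complex]_(m, n))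
    (C : 'M[complex]_(n, m)) (D : 'M[complex]_n) (x : 'cV[complex]_n) :
  qf (block_mx A B C D) (col_mx 0 x) = qf D x.
Proof.
rewrite /qf -mulmxA mul_block_col ctr_col_mx mul_row_col !mulmx0 !add0r.
by rewrite ctr0 mul0mx add0r mulmxA.
Qed.

Lemma ctr_schur (m n : nat) (A : 'M[complex]_m) (B : 'M[complex]_(m, n))
    (D : 'M[complex]_n) :
  ctr A = A -> ctr D = D ->
  ctr (D - ctr B *m invmx A *m B) = D - ctr B *m invmx A *m B.
Proof. by move=> hA hD; rewrite ctrD ctrN !ctrM ctrK ctrV hA hD mulmxA. Qed.

Lemma herm_entry (n : nat) (A : 'M[complex]_n) (i : 'I_n) :
  ctr A = A -> A i i = RtoC (cre (A i i)).
Proof.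
move=> hA; have : conjc (A i i) = A i i by rewrite -{2}hA !mxE.
move=> /(f_equal cim) /= h; apply: complex_eq => //=; lra.
Qed.

(** * Traces, the logarithmic determinant bound, and a Cholesky factorization *)

Lemma rtrD (n : nat) (A B : 'M[complex]_n) :
  rtr (A + B) = Rplus (rtr A) (rtr B).
Proof. by rewrite /rtr mxtraceD. Qed.

Lemma rtrB (n : nat) (A B : 'M[complex]_n) :
  rtr (A - B) = Rminus (rtr A) (rtr B).
Proof. by rewrite /rtr raddfB. Qed.

Lemma rtrZ (n : nat) (r : R) (A : 'M[complex]_n) :
  rtr (RtoC r *: A) = Rmult r (rtr A).
Proof. by rewrite /rtr mxtraceZ cre_scale. Qed.

Lemma rtr_mulC (m n : nat) (A : 'M[complex]_(m, n)) (B : 'M[complex]_(n, m)) :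
  rtr (A *m B) = rtr (B *m A).
Proof. by rewrite /rtr mxtrace_mulC. Qed.

Lemma rtr1 (n : nat) : rtr (1%:M : 'M[complex]_n) = INR n.
Proof.
rewrite /rtr mxtrace1; elim: n => [|n IH] //.
by rewrite mulrS creD IH S_INR Rplus_comm.
Qed.

Lemma ln_le_sub1 (x : R) : Rlt 0 x -> Rle (ln x) (Rminus x 1).
Proof. by move=> x0; have := exp_ineq1_le (ln x); rewrite exp_ln //; lra. Qed.

(** Induction through the Schur complement of the first diagonal entry [a], so no eigenvalues are
    needed. The bound adds up [ln a <= a - 1], and the part [c a^-1 b] removed from [D] has
    nonnegative trace. *)
Lemma det_pd (n : nat) (A : 'M[complex]_n) :
  pd A -> exists2 d, \det A = RtoC d &
    Rlt 0 d /\ Rle (ln d) (Rminus (rtr A) (INR n)).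
Proof.
elim: n A => [|n IH] A.
  move=> _; exists R1; first by rewrite det_mx00.
  by rewrite /rtr /mxtrace big_ord0 ln_1 /=; split; lra.
rewrite -[A](@submxK _ 1 n 1 n); move: (ulsubmx _) (ursubmx _) (dlsubmx _) (drsubmx _).
move=> {A} a b c D [hA qA].
have [ha _ hc hD] : [/\ ctr a = a, ctr c = b, ctr b = c & ctr D = D].
  by apply: eq_block_mx; rewrite -(@ctr_block_mx 1 n 1 n).
have pa : pd a.
  split=> // v v0; rewrite -(qf_ul a b c D); apply: qA.
  by apply: contra_neq v0 => h; rewrite -[v](@col_mxKu _ 1 n 1 v 0) h linear0.
have ua := pd_unitmx pa.
have pS : pd (D - c *m invmx a *m b).
  split=> [|v v0]; first by rewrite -hc; exact: ctr_schur.
  rewrite -qf_schur //; apply: qA.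
  by apply: contra_neq v0 => h; rewrite -[v](@col_mxKd _ 1 n 1 (- (invmx a *m b *m v)) v) h linear0.
have [d dS [d0 ld]] := IH _ pS.
have a00 : Rlt 0 (cre (a 0 0)).
  have := pa.2 1%:M (oner_neq0 _).
  by rewrite /qf mulmx1 ctr1 mul1mx.
exists (Rmult (cre (a 0 0)) d).
  by rewrite (@det_schur_ul _ 1 n) // det_mx11 herm_entry // dS RtoC_mul.
split; first exact: Rmult_lt_0_compat.
have trE : rtr (block_mx a b c D) = Rplus (cre (a 0 0)) (rtr D).
  by rewrite /rtr mxtrace_block trace_mx11.
rewrite ln_mult // trE S_INR.
have := ln_le_sub1 a00.
have trS (M : 'M[complex]_n) : psd M ->
    Rle (ln d) (Rminus (rtr (D - M)) (INR n)) ->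
    Rle (ln d) (Rminus (rtr D) (INR n)).
  by move=> /psd_tr; rewrite rtrB; lra.
have := trS _ _ ld; rewrite -hc => /(_ (psd_congr _ (pd_psd (pdV pa)))); lra.
Qed.

(** Cholesky factorization by induction on the size: a positive pivot is eliminated, and a zero
    pivot forces the rest of its row and column to vanish. *)
Lemma psd_factor (n : nat) (A : 'M[complex]_n) :
  psd A -> exists G : 'M[complex]_n, A = G *m ctr G.
Proof.
elim: n A => [|n IH] A; first by exists 0; apply/matrixP; case.
rewrite -[A](@submxK _ 1 n 1 n); move: (ulsubmx _) (ursubmx _) (dlsubmx _) (drsubmx _).
move=> {A} a b c D pA; have [hA _] := pA.
have qA (v : 'cV[complex]_(1 + n)) : Rle 0 (qf (block_mx a b c D) v) := pA.2 v.
have [ha hb hc hD] : [/\ ctr a = a, ctr c = b, ctr b = c & ctr D = D].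
  by apply: eq_block_mx; rewrite -(@ctr_block_mx 1 n 1 n).
have [x x0 ax] : exists2 x, Rle 0 x & a = (RtoC x)%:M.
  exists (cre (a 0 0)); last by rewrite -herm_entry // -mx11_scalar.
  have := qA (col_mx (1%:M : 'M_1) (0 : 'cV_n)).
  by rewrite qf_ul /qf mulmx1 ctr1 mul1mx.
case: (Rle_lt_or_eq_dec _ _ x0) => [xpos|xe].
  have sq0 : Rlt 0 (sqrt x) by exact: sqrt_lt_R0.
  have ua : a \in unitmx.
    rewrite ax unitmxE det_scalar1 unitfE; apply/eqP => /(f_equal cre) /=; lra.
  have [G GE] : exists G : 'M_n, D - c *m invmx a *m b = G *m ctr G.
    apply: IH; split=> [|v]; first by rewrite -hc; exact: ctr_schur.
    by rewrite -/(qf _ _) -qf_schur //; exact: qA.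
  (* The first column is that of the matrix divided by the square root of the pivot; [G] factors the
     Schur complement. *)
  exists (block_mx (RtoC (sqrt x))%:M 0 (RtoC (Rinv (sqrt x)) *: c) G).
  have hs : ctr (RtoC (sqrt x))%:M = (RtoC (sqrt x))%:M :> 'M_1.
    by rewrite /ctr map_scalar_mx tr_scalar_mx /= conjc_RtoC.
  rewrite (@ctr_block_mx 1 n 1 n) (@mulmx_block _ 1 n 1 n 1 n).
  rewrite !ctr0 !mulmx0 !mul0mx !addr0 hs -scalar_mxM RtoC_mul sqrt_sqrt //.
  rewrite ctrZ conjc_RtoC hb -!scalemxAr mul_mx_scalar mul_scalar_mx !scalerA.
  rewrite -scalemxAl scalerA !RtoC_mul -GE.
  rewrite (Rmult_comm (Rinv _) (sqrt x)).
  have -> : RtoC (Rmult (sqrt x) (Rinv (sqrt x))) = 1.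
    by rewrite Rinv_r //; apply: Rgt_not_eq.
  have -> : Rmult (Rinv (sqrt x)) (Rinv (sqrt x)) = Rinv x.
    by rewrite -Rinv_mult sqrt_sqrt.
  have -> : invmx a = (RtoC (Rinv x))%:M by rewrite ax invmx_scalar RtoC_inv //; lra.
  by rewrite !scale1r -ax mul_mx_scalar -scalemxAl addrC subrK.
have a0 : a = 0 by rewrite ax -xe; apply/matrixP => i j; rewrite !mxE mul0rn.
(* The form vanishes at the first basis vector, so [psd_qf0] makes the whole first column zero. *)
have c0 : c = 0.
  have : block_mx a b c D *m col_mx (1%:M : 'M_1) (0 : 'cV_n) = 0.
    apply: psd_qf0 => //; rewrite qf_ul a0 /qf mulmx0 mul0mx mxE //.
  rewrite mul_block_col !mulmx1 !mulmx0 !addr0 => h.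
  by rewrite -[c](@col_mxKd _ 1 n 1 a c) h linear0.
have [G GE] : exists G : 'M_n, D = G *m ctr G.
  apply: IH; split=> // v.
  by rewrite -/(qf _ _) -(qf_dr a b c); exact: qA.
exists (block_mx (0 : 'M_1) 0 0 G).
rewrite (@ctr_block_mx 1 n 1 n) (@mulmx_block _ 1 n 1 n 1 n) -hb c0 a0 !ctr0.
by rewrite !mulmx0 !mul0mx !addr0 add0r -GE.
Qed.

(** * Differences of inverses, and a trace bound on an inverse *)

Lemma resolvent (n : nat) (A S : 'M[complex]_n) :
  A \in unitmx -> A + S \in unitmx ->
  invmx A - invmx (A + S) = invmx (A + S) *m S *m invmx A /\
  invmx A - invmx (A + S) = invmx A *m S *m invmx (A + S).
Proof.
have : S = (A + S) - A by rewrite addrC addKr.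
move: (A + S) => B -> uA uB; split; rewrite mulmxBr mulmxBl mulVmx // mul1mx.
  by rewrite mulmxK.
by rewrite mulmxK.
Qed.

(** Replacing [A^-1] in the first resolvent identity by means of the second leaves two Hermitian
    congruences when [A] and [S] are Hermitian, from which positivity can be read off. *)
Lemma resolvent_sym (n : nat) (A S : 'M[complex]_n) :
  A \in unitmx -> A + S \in unitmx ->
  invmx A - invmx (A + S) =
    invmx (A + S) *m S *m invmx (A + S) +
    invmx (A + S) *m S *m invmx A *m S *m invmx (A + S).
Proof.
move=> uA uB; have [e1 e2] := resolvent uA uB.
rewrite {1}e1 -[X in _ *m _ *m X = _](subrK (invmx (A + S))) e2.
by rewrite mulmxDr addrC !mulmxA.
Qed.

Lemma psd_inv_diff (n : nat) (A S : 'M[complex]_n) :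
  pd A -> psd S -> psd (invmx A - invmx (A + S)).
Proof.
move=> pA pS; have pB := pdD pA pS.
rewrite resolvent_sym; [|exact: pd_unitmx..].
have [hQ _] := pdV pB; have [hS _] := pS.
apply: psdD; first by rewrite -{1}hQ; exact: psd_congr.
have -> : invmx (A + S) *m S *m invmx A *m S *m invmx (A + S) =
    ctr (S *m invmx (A + S)) *m invmx A *m (S *m invmx (A + S)).
  by rewrite ctrM hS hQ !mulmxA.
exact/psd_congr/pd_psd/pdV.
Qed.

(* The inverse of [E + t K^+ Phi^-1 K] is, as in a parallel sum, the minimum over
   [G] of [(I - K^+ G)^+ E^-1 (I - K^+ G) + G^+ Phi G / t]; a [G] with
   [E = I - K^+ G] turns this into [E + G^+ Phi G / t], without inverses. *)
Lemma tr_inv_parallel (n p : nat) (E : 'M[complex]_n) (Phi : 'M[complex]_p)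
    (K G : 'M[complex]_(p, n)) (t : R) :
  Rlt 0 t -> pd E -> pd Phi -> E + ctr K *m G = 1%:M ->
  Rle (rtr (invmx (E + RtoC t *: (ctr K *m invmx Phi *m K))))
      (Rplus (rtr E) (Rmult (Rinv t) (rtr (ctr G *m Phi *m G)))).
Proof.
move=> t0 pE pPhi EKG; have [hE _] := pE; have [hPhi _] := pPhi.
have uPhi := pd_unitmx pPhi.
set X := E + _; pose Y := invmx X.
have pX : pd X.
  by apply: pdD => //; apply: psdZ; [lra|exact/psd_congr/pd_psd/pdV].
have uX := pd_unitmx pX; have [hY _] : pd Y := pdV pX.
have TT : RtoC (Rinv t) * RtoC t = 1.
  by rewrite RtoC_mul Rinv_l //; apply: Rgt_not_eq.
(* [U] is the minimizing [G]: it satisfies [I - K^+ U = E Y], and the minimum is [Y]. *)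
pose U := RtoC t *: (invmx Phi *m K *m Y).
have PhiU : Phi *m U = RtoC t *: (K *m Y).
  by rewrite /U -scalemxAr !mulmxA mulmxV // mul1mx.
have UPhi : ctr U *m Phi = RtoC t *: (Y *m ctr K).
  by rewrite -[Phi]hPhi -ctrM PhiU ctrZ conjc_RtoC ctrM hY.
have YKU : Y *m ctr K *m U = Y - Y *m E *m Y.
  have -> : Y *m ctr K *m U = Y *m (X - E) *m Y.
    by rewrite /X addrC addKr /U -!scalemxAr -!scalemxAl !mulmxA.
  by rewrite mulmxBr mulmxBl mulVmx // mul1mx.
(* Only the three identities are used from here on, so the body of [U] is forgotten. *)
move: U PhiU UPhi YKU => U PhiU UPhi YKU.
have KG : ctr K *m G = 1%:M - E by rewrite -EKG addrC addKr.
have GK : ctr G *m K = 1%:M - E by rewrite -[K]ctrK -ctrM KG ctrD ctrN ctr1 hE.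
(* The cross terms, which enter the two squares below with opposite signs. *)
pose g := E *m Y + Y *m E - Y *m E *m Y.
have W1 : ctr (1%:M - Y) *m E *m (1%:M - Y) = E - g.
  rewrite ctrD ctrN ctr1 hY mulmxBl mul1mx mulmxBr mulmx1 mulmxBl /g.
  rewrite !opprB opprD !addrA [RHS]addrAC; congr (_ - _); exact: addrAC.
have W2 : RtoC (Rinv t) *: (ctr (G - U) *m Phi *m (G - U)) =
    RtoC (Rinv t) *: (ctr G *m Phi *m G) - Y + g.
  rewrite ctrD ctrN mulmxBl UPhi mulmxBr !mulmxBl -(mulmxA _ Phi U) PhiU.
  rewrite !scalerBr -!scalemxAl -!scalemxAr !scalerA TT !scale1r.
  rewrite [_ *m (K *m Y)]mulmxA GK -(mulmxA Y) KG YKU.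
  rewrite mulmxBl mulmxBr mul1mx mulmx1 !opprB.
  have -> : Y - Y *m E *m Y + (E *m Y - Y) = E *m Y - Y *m E *m Y.
    by rewrite addrC addrA subrK.
  rewrite /g !addrA; congr (_ - _); rewrite [RHS]addrAC; congr (_ + _); exact: addrAC.
(* Completing the square: the excess over the minimum [Y] is a sum of two congruences. The first has
   [E] in the middle because [(I - K^+ G) - (I - K^+ U) = E (I - Y)]. *)
have Z : E + RtoC (Rinv t) *: (ctr G *m Phi *m G) - Y =
    ctr (1%:M - Y) *m E *m (1%:M - Y) +
    RtoC (Rinv t) *: (ctr (G - U) *m Phi *m (G - U)).
  by rewrite W1 W2 [RHS]addrC addrACA addrN addr0 addrC addrA.
have tr_le (r : R) (B M : 'M[complex]_n) : psd (E + RtoC r *: B - M) ->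
    Rle (rtr M) (Rplus (rtr E) (Rmult r (rtr B))).
  by move/psd_tr; rewrite rtrB rtrD rtrZ; lra.
apply: tr_le; rewrite Z; apply: psdD; first exact/psd_congr/pd_psd.
by apply: psdZ; [exact/Rlt_le/Rinv_0_lt_compat|exact/psd_congr/pd_psd].
Qed.

(** * Log-determinants and the inequality for a single link *)

Lemma det_pd_re (n : nat) (A : 'M[complex]_n) :
  pd A -> \det A = RtoC (cre (\det A)) /\ Rlt 0 (cre (\det A)).
Proof. by case/det_pd=> d -> [d0 _]. Qed.

Lemma ldet_pd_le (n : nat) (A : 'M[complex]_n) :
  pd A -> Rle (ldet A) (Rminus (rtr A) (INR n)).
Proof. by rewrite /ldet; case/det_pd=> d -> []. Qed.

(** Realness of the determinants lets [cre] pass through the products. The sizes may differ, as they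
    do for the two Schur complements of one block matrix. *)
Lemma ldet_mul_eq (m n p q : nat) (A : 'M[complex]_m) (B : 'M[complex]_n)
    (C : 'M[complex]_p) (D : 'M[complex]_q) :
  pd A -> pd B -> pd C -> pd D -> \det A * \det B = \det C * \det D ->
  Rplus (ldet A) (ldet B) = Rplus (ldet C) (ldet D).
Proof.
move=> /det_pd_re [eA pA] /det_pd_re [eB pB] /det_pd_re [eC pC] /det_pd_re [eD pD] e.
rewrite /ldet -!ln_mult //; congr ln.
by move: e; rewrite eA eB eC eD !RtoC_mul => /(f_equal cre).
Qed.

Lemma ldet_inv (n : nat) (A : 'M[complex]_n) :
  pd A -> ldet (invmx A) = Ropp (ldet A).
Proof.
move=> pA; have uA := pd_unitmx pA.
have ln1 : ldet (1%:M : 'M[complex]_n) = R0 by rewrite /ldet det1 ln_1.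
have e : \det A * \det (invmx A) = \det (1%:M : 'M[complex]_n) * \det (1%:M : 'M[complex]_n).
  by rewrite -!det_mulmx mulmxV // mulmx1.
by have := ldet_mul_eq pA (pdV pA) (pd1 n) (pd1 n) e; rewrite ln1; lra.
Qed.

(** The original rate exceeds the reversed one by [- ln |X|] for a single matrix [X]. This equals
    [ln |X^-1|], which is at most [tr X^-1 - n], and [tr_inv_parallel] bounds the trace. *)
Lemma link_duality (m n : nat) (Om : 'M[complex]_m) (Phi : 'M[complex]_n)
    (H : 'M[complex]_(m, n)) (Sig : 'M[complex]_n) (OmS D : 'M[complex]_m) (t : R) :
  pd Om -> pd Phi -> psd Sig -> Rlt 0 t ->
  OmS = Om + H *m Sig *m ctr H -> D = invmx Om - invmx OmS ->
  Rle (Rplus (Rminus (ldet OmS) (ldet Om)) (rtr (D *m Om)))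
      (Rplus (Rminus (ldet (Phi + RtoC t *: (ctr H *m D *m H)))
                     (ldet Phi))
             (Rmult (Rinv t) (rtr (Sig *m Phi)))).
Proof.
move=> pOm pPhi pSig t0 OmSdef Ddef.
have uPhi := pd_unitmx pPhi.
have pS : psd (H *m Sig *m ctr H) by rewrite -{1}[H]ctrK; exact: psd_congr.
have pOmS : pd OmS by rewrite OmSdef; exact: pdD.
have uOm := pd_unitmx pOm; have uOmS := pd_unitmx pOmS.
have pD : psd D by rewrite Ddef OmSdef; exact: psd_inv_diff.
have [G SigE] := psd_factor pSig.
pose F := H *m G; pose Q := invmx OmS; pose P := invmx Om.
have SE : H *m Sig *m ctr H = F *m ctr F by rewrite SigE /F ctrM !mulmxA.
have OmSE : OmS = Om + F *m ctr F by rewrite OmSdef SE.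
have [hQ _] : pd Q := pdV pOmS.
(* [E] is the inverse of [M] (Woodbury), so [-ln |E|] is the rate of the original
   link, while [ln |X| - ln |E|] below is the rate of the reversed one. *)
pose E := 1%:M - ctr F *m Q *m F.
pose M := 1%:M + ctr F *m P *m F.
have pM : pd M by apply: pdD; [exact: pd1|exact/psd_congr/pd_psd/pdV].
have uM := pd_unitmx pM.
have uOmFS := uOmS; rewrite OmSE in uOmFS.
have [DE' _] := resolvent uOm uOmFS; rewrite -OmSE -/Q -/P in DE'.
have EM : E *m M = 1%:M.
  have ab : ctr F *m Q *m F + ctr F *m Q *m F *m (ctr F *m P *m F) = ctr F *m P *m F.
    have -> : ctr F *m Q *m F *m (ctr F *m P *m F) = ctr F *m (P - Q) *m F.
      by rewrite DE' !mulmxA.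
    by rewrite mulmxBr mulmxBl addrC subrK.
  by rewrite mulmxBl mul1mx mulmxDr mulmx1 ab /M addrK.
have EV : E = invmx M by rewrite -[E]mulmx1 -(mulmxV uM) mulmxA EM mul1mx.
have pE : pd E by rewrite EV; exact: pdV.
have VE : invmx E = M by rewrite EV invmxK.
have uE := pd_unitmx pE.
(* [K] serves twice: [K E^-1 K^+ = H^+ D H] is the reversed signal term up to [t], and
   [E + K^+ G = I] is the relation required by [tr_inv_parallel]. *)
pose K := ctr H *m Q *m F.
have hK : ctr K = ctr F *m Q *m H by rewrite /K !ctrM ctrK hQ mulmxA.
pose X := E + RtoC t *: (ctr K *m invmx Phi *m K).
have pX : pd X.
  by apply: pdD => //; apply: psdZ; [lra|exact/psd_congr/pd_psd/pdV].
have KMK : K *m invmx E *m ctr K = ctr H *m D *m H.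
  rewrite VE hK /M mulmxDr mulmx1 mulmxDl Ddef OmSE resolvent_sym // -OmSE -/Q -/P.
  by rewrite mulmxDr mulmxDl /K !mulmxA.
pose PhiS := Phi + RtoC t *: (ctr H *m D *m H).
have pPhiS : pd PhiS.
  by apply: pdD => //; apply: psdZ; [lra|exact: psd_congr].
(* Both determinant identities compute a block determinant by its two Schur complements. *)
have det1E : \det OmS * \det E = \det (1%:M : 'M[complex]_n) * \det Om.
  rewrite -det_schur_ul // det_schur_dr ?unitmx1 // invmx1 mulmx1.
  by rewrite OmSE addrK.
have det2E : \det Phi * \det X = \det E * \det PhiS.
  have -> : X = E - (- ctr K) *m invmx Phi *m (RtoC t *: K).
    by rewrite -scalemxAr !mulNmx scalerN opprK.
  have -> : PhiS = Phi - (RtoC t *: K) *m invmx E *m (- ctr K).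
    by rewrite mulmxN -!scalemxAl KMK opprK.
  by rewrite -det_schur_ul // det_schur_dr.
have l1 := ldet_mul_eq pOmS pE (pd1 n) pOm det1E.
have l2 := ldet_mul_eq pPhi pX pE pPhiS det2E.
have lX := ldet_pd_le (pdV pX); rewrite ldet_inv // in lX.
have KG : E + ctr K *m G = 1%:M.
  by rewrite hK -mulmxA -/F /E subrK.
have lt := tr_inv_parallel t0 pE pPhi KG.
(* Since [D Om = Q F F^+], this trace is [n - tr E]; the [n] cancels the one in the bound on
   [ln |X^-1|]. *)
have tD : rtr (D *m Om) = rtr (ctr F *m Q *m F).
  by rewrite Ddef DE' mulmxKV // mulmxA [LHS]rtr_mulC mulmxA.
have tS : rtr (Sig *m Phi) = rtr (ctr G *m Phi *m G).
  by rewrite SigE -mulmxA rtr_mulC.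
have tE : rtr E = Rminus (INR n) (rtr (ctr F *m Q *m F)).
  by rewrite /E rtrB rtr1.
have ln1 : ldet (1%:M : 'M[complex]_n) = R0 by rewrite /ldet det1 ln_1.
rewrite tD tS -/PhiS.
rewrite ln1 in l1; rewrite tE in lt; rewrite -/X in lt.
lra.
Qed.

(** * The reciprocal network and the balance of traces *)

Definition dual_channel (L : nat) (LT LR : 'I_L -> nat)
    (H : forall l k : 'I_L, 'M[complex]_(LR l, LT k)) :
    forall l k : 'I_L, 'M[complex]_(LT l, LR k) :=
  fun l k => ctr (H k l).

(** Brings the bound from the second half step back to the original network. *)
Lemma dual_channelK (L : nat) (LT LR : 'I_L -> nat)
    (H : forall l k : 'I_L, 'M[complex]_(LR l, LT k)) :
  dual_channel (dual_channel H) = H.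
Proof.
apply: functional_extensionality_dep => l; apply: functional_extensionality_dep => k.
exact: ctrK.
Qed.

(** The rates are iterated [Rplus], while the correction is summed in [complex], where ring lemmas
    on big sums show that it vanishes. *)
Lemma big_Rplus_le (I : Type) (r : seq I) (x y : I -> R) (z : I -> complex) :
  (forall i, Rle (x i) (Rplus (y i) (cre (z i)))) ->
  Rle (\big[Rplus/R0]_(i <- r) x i)
      (Rplus (\big[Rplus/R0]_(i <- r) y i) (cre (\sum_(i <- r) z i))).
Proof.
move=> h; elim/big_rec3: _ => [|i a b c _ IH] /=; first lra.
suff : Rle (Rplus (x i) c) (Rplus (Rplus (y i) b) (Rplus (cre (z i)) (cre a))) by [].
by have := h i; lra.
Qed.

Lemma Omega_pd (L : nat) (LT LR : 'I_L -> nat)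
    (H : forall l k : 'I_L, 'M[complex]_(LR l, LT k)) (S : Cov LT) (l : 'I_L) :
  (forall k, psd (S k)) -> pd (Omega H S l).
Proof.
move=> pS; apply: pdD; first exact: pd1.
elim/big_ind: _ => [|A B|k _]; [exact: psd0|exact: psdD|].
by rewrite -{1}[H l k]ctrK; exact: psd_congr.
Qed.

(** The identity parts of [Omega] contribute the two equal total traces; the interference sums agree
    after swapping the indices and cycling the traces. *)
Lemma trace_duality (L : nat) (LT LR : 'I_L -> nat)
    (H : forall l k : 'I_L, 'M[complex]_(LR l, LT k)) (S : Cov LT) (T : Cov LR) :
  \sum_l \tr (S l) = \sum_l \tr (T l) ->
  \sum_l \tr (S l *m Omega (dual_channel H) T l) = \sum_l \tr (T l *m Omega H S l).
Proof.
move=> trST.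
have expand (LT' LR' : 'I_L -> nat) (H' : forall l k : 'I_L, 'M[complex]_(LR' l, LT' k))
    (S' : Cov LT') (T' : Cov LR') : \sum_l \tr (T' l *m Omega H' S' l) =
    \sum_l \tr (T' l) + \sum_l \sum_(k | k != l) \tr (T' l *m (H' l k *m S' k *m ctr (H' l k))).
  rewrite -big_split; apply: eq_bigr => l _.
  by rewrite /Omega mulmxDr mulmx1 mxtraceD mulmx_sumr raddf_sum.
rewrite !expand trST; congr (_ + _).
rewrite (exchange_big_dep predT) //=; apply: eq_bigr => k _.
apply: eq_big => [l|l _]; first by rewrite eq_sym.
by rewrite /dual_channel ctrK mxtrace_mulC -!mulmxA mxtrace_mulC !mulmxA.
Qed.

(** * One half iteration: from a network to its reciprocal *)

Section HalfStep.
Variables (L : nat) (LT LR : 'I_L -> nat).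
Variables (H : forall l k : 'I_L, 'M[complex]_(LR l, LT k)) (w : 'I_L -> R) (PT : R).
Variable S : Cov LT.
Hypotheses (w_gt0 : forall l, Rlt 0 (w l)) (PT_gt0 : Rlt 0 PT).
Hypotheses (psdS : forall l, psd (S l)) (trS : \sum_(l < L) \tr (S l) = RtoC PT).
Hypothesis den_gt0 : cpos (fwd_denom H w S).

(** The scale common to all links: [c * w l] is the [t] of [link_duality] on link [l]. *)
Let c := Rdiv PT (cre (fwd_denom H w S)).

Let denE : fwd_denom H w S = RtoC (cre (fwd_denom H w S)).
Proof. by case: den_gt0 => im0 _; apply: complex_eq. Qed.

Let c_gt0 : Rlt 0 c.
Proof. by case: den_gt0 => _ ?; apply: Rdiv_lt_0_compat. Qed.

Let den_neq0 : fwd_denom H w S != 0.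
Proof. by apply/eqP => d0; case: den_gt0; rewrite d0 /=; lra. Qed.

Lemma SigHatE (l : 'I_L) : SigHat H w PT S l = RtoC (Rmult c (w l)) *: fwdD H S l.
Proof.
rewrite /SigHat; congr (_ *: _); rewrite denE RtoC_inv ?RtoC_mul /c.
  by congr RtoC; rewrite /Rdiv; ring.
by case: den_gt0 => _ ?; lra.
Qed.

Lemma psd_SigHat (l : 'I_L) : psd (SigHat H w PT S l).
Proof.
rewrite SigHatE; apply: psdZ; first exact/Rlt_le/Rmult_lt_0_compat.
apply: psd_inv_diff; first exact: Omega_pd.
by rewrite -{1}[H l l]ctrK; exact: psd_congr.
Qed.

Lemma tr_SigHat : \sum_(l < L) \tr (SigHat H w PT S l) = RtoC PT.
Proof.
transitivity (RtoC PT / fwd_denom H w S * fwd_denom H w S); last by rewrite divfK.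
rewrite {2}/fwd_denom mulr_sumr; apply: eq_bigr => l _.
by rewrite mxtraceZ -RtoC_mul mulrA [RtoC PT * _ / _]mulrAC.
Qed.

Lemma Vrate_SigHat_ge : Rle (Vrate H w S) (Vrate (dual_channel H) w (SigHat H w PT S)).
Proof.
set T := SigHat H w PT S.
(* The slack of [link_duality] times [w l]. With [t = c * w l] and [T l = t D_l], both trace terms
   get the same factor [1 / c], free of the weights, so [trace_duality] applies to the sum. *)
pose z l := RtoC (Rinv c) *
  (\tr (S l *m Omega (dual_channel H) T l) - \tr (T l *m Omega H S l)).
have z0 : \sum_l z l = 0.
  rewrite -mulr_sumr sumrB trace_duality ?subrr ?mulr0 //.
  by rewrite trS tr_SigHat.
apply: (Rle_trans _ (Rplus (Vrate (dual_channel H) w T) (cre (\sum_l z l)))); last first.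
  by rewrite z0 Rplus_0_r; exact: Rle_refl.
apply: big_Rplus_le => l.
suff : Rle (Rmult (w l) (Rminus (ldet (OmegaS H S l)) (ldet (Omega H S l))))
    (Rplus (Rmult (w l) (Rminus (ldet (OmegaS (dual_channel H) T l))
                                (ldet (Omega (dual_channel H) T l)))) (cre (z l))) by [].
have t_gt0 : Rlt 0 (Rmult c (w l)) by exact: Rmult_lt_0_compat.
have -> : cre (z l) = Rmult (w l) (Rminus
    (Rmult (Rinv (Rmult c (w l))) (rtr (S l *m Omega (dual_channel H) T l)))
    (rtr (fwdD H S l *m Omega H S l))).
  rewrite /z cre_scale creD creN /T SigHatE -scalemxAl -!/(rtr _) rtrZ -/T.
  by field; split; [have := w_gt0 l|have := c_gt0]; lra.
have SE : Omega (dual_channel H) T l + RtoC (Rmult c (w l)) *: (ctr (H l l) *m fwdD H S l *m H l l)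
    = OmegaS (dual_channel H) T l.
  by rewrite /OmegaS /T SigHatE /dual_channel ctrK -scalemxAr -scalemxAl.
have h : Rle (Rplus (Rminus (ldet (OmegaS H S l)) (ldet (Omega H S l)))
                    (rtr (fwdD H S l *m Omega H S l)))
             (Rplus (Rminus (ldet (OmegaS (dual_channel H) T l))
                            (ldet (Omega (dual_channel H) T l)))
                    (Rmult (Rinv (Rmult c (w l)))
                           (rtr (S l *m Omega (dual_channel H) T l)))).
  rewrite -SE; exact: (@link_duality _ _ _ _ (H l l) _ (OmegaS H S l) (fwdD H S l) _
    (Omega_pd H l psdS) (Omega_pd (dual_channel H) l psd_SigHat) (psdS l) t_gt0 erefl erefl).
have lin a b e f : Rle (Rplus a e) (Rplus b f) ->
    Rle (Rmult (w l) a) (Rplus (Rmult (w l) b) (Rmult (w l) (Rminus f e))).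
  by move=> /(Rmult_le_compat_l _ _ _ (Rlt_le _ _ (w_gt0 l))); lra.
exact: lin h.
Qed.

End HalfStep.

(** The backward pass is a forward pass through the reciprocal network, so an iteration applies
    [SigHat] twice. *)
Lemma DLA_stepE (L : nat) (LT LR : 'I_L -> nat)
    (H : forall l k : 'I_L, 'M[complex]_(LR l, LT k)) (w : 'I_L -> R) (PT : R)
    (S : Cov LT) :
  bwd_denom H w PT S = fwd_denom (dual_channel H) w (SigHat H w PT S) /\
  DLA_step H w PT S = SigHat (dual_channel H) w PT (SigHat H w PT S).
Proof.
have OmE l : OmegaHat H w PT S l = Omega (dual_channel H) (SigHat H w PT S) l.
  by congr (_ + _); apply: eq_bigr => k _; rewrite /dual_channel ctrK.
have DE l : bwdD H w PT S l = fwdD (dual_channel H) (SigHat H w PT S) l.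
  by rewrite /bwdD /fwdD /OmegaHatS /OmegaS OmE /dual_channel ctrK.
have dE : bwd_denom H w PT S = fwd_denom (dual_channel H) w (SigHat H w PT S).
  by apply: eq_bigr => l _; rewrite DE.
split=> //; apply: functional_extensionality_dep => l.
by rewrite /DLA_step dE DE.
Qed.

Unset Implicit Arguments.

Theorem theorem1 (L : nat) (LT LR : 'I_L -> nat)
    (H : forall l k : 'I_L, 'M[complex]_(LR l, LT k)) (w : 'I_L -> R) (PT : R)
    (Sig : nat -> forall l : 'I_L, 'M[complex]_(LT l)) :
  (0 < L)%N ->
  (forall l, Rlt 0 (w l)) ->
  Rlt 0 PT ->
  (forall l, psd (Sig 0%N l)) ->
  \sum_(l < L) \tr (Sig 0%N l) = RtoC PT ->
  (forall n, cpos (fwd_denom H w (Sig n)) /\ cpos (bwd_denom H w PT (Sig n))) ->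
  (forall n, Sig n.+1 = DLA_step H w PT (Sig n)) ->
  forall n, Rle (Vrate H w (Sig n)) (Vrate H w (Sig n.+1)).
Proof.
move=> _ w0 PT0 psdSig0 trSig0 den step.
(* Semidefiniteness and total trace [PT] persist, so the half-step lemmas apply at every iterate. *)
have inv n : (forall l, psd (Sig n l)) /\ \sum_(l < L) \tr (Sig n l) = RtoC PT.
  elim: n => // n [psdn _]; have [dE stepE] := DLA_stepE H w PT (Sig n).
  have [d1 d2] := den n; rewrite dE in d2.
  have psdT := psd_SigHat w0 PT0 psdn d1.
  rewrite step stepE.
  exact: (conj (psd_SigHat w0 PT0 psdT d2) (tr_SigHat PT d2)).
move=> n; have [psdn trn] := inv n; have [dE stepE] := DLA_stepE H w PT (Sig n).
have [d1 d2] := den n; rewrite dE in d2.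
have psdT := psd_SigHat w0 PT0 psdn d1.
have V1 := Vrate_SigHat_ge w0 PT0 psdn trn d1.
(* The second half starts from [SigHat] in the reciprocal network, where its total trace is again
   [PT]. *)
have V2 := Vrate_SigHat_ge w0 PT0 psdT (tr_SigHat PT d1) d2.
rewrite dual_channelK -stepE -step in V2.
exact: Rle_trans V1 V2.
Qed.
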